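(* Let $w\ge 0$ be an integer, let $T\subset\mathbb{N}=\{1,2,\dots\}$ be finite, let $f$ be a fixed monic polynomial over $\mathbb{F}_q$, let $m\ge 0$ be an integer, and let $l_i\ge 0$ be integers for $i\in T$. Let $N^*(m,\prod_{i\in T}I_i^{l_i},\langle f\rangle)$ be the number of monic polynomials $g$ over $\mathbb{F}_q$ of degree $m$ with $\langle g\rangle=\langle f\rangle$ such that, for each $i\in T$, $g$ has exactly $l_i$ monic irreducible factors of degree $i$ counted with multiplicity. Then $$N^*\Big(m,\prod_{i\in T}I_i^{l_i},\langle f\rangle\Big)=q^{m-w}\sum_{(j_i)_{i\in T}}\mathbf{1}\Big[\sum_{i\in T}i(l_i+j_i)\le m\Big]\prod_{i\in T}\binom{|I_i|+l_i-1}{l_i}q^{-il_i}\binom{|I_i|}{j_i}(-1)^{j_i}q^{-ij_i}$$ $$\qquad+\Big[\langle f\rangle z^m\prod_{i\in T}u_i^{l_i}\Big]\;J\Big(\sum_{d=0}^{w-1}\sum_{h\in M_d}\langle h\rangle z^d\Big)\prod_{i\in T}\prod_{g\in I_i}\left(\frac{1-\langle g\rangle z^i}{1-\langle g\rangle z^iu_i}\right),$$ where the first sum runs over all tuples $(j_i)_{i\in T}$ of integers with $0\le j_i\le |I_i|$.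
   Context: $\mathbb{F}_q$ is a finite field with $q=p^e$ elements, $p$ prime, $e\ge1$. $M$ is the set of monic polynomials over $\mathbb{F}_q$, $M_d$ the set of those of degree $d$, and $I_i$ the set of monic irreducible polynomials of degree $i$ over $\mathbb{F}_q$. For $f\in M$ of degree $d(f)$ write $f=x^{d(f)}+f_1x^{d(f)-1}+\cdots+f_{d(f)}$ and set $f_j=0$ for $j>d(f)$. For the fixed integer $w\ge0$, $\langle f\rangle$ denotes $x^{d(f)}f(1/x) \bmod x^{w+1}$, i.e. the class of $1+f_1x+\cdots+f_wx^w$ modulo $x^{w+1}$. $G=\{\langle f\rangle: f\in M\}$ is an abelian group of order $q^w$ under $\langle f\rangle\langle g\rangle=\langle fg\rangle$, with identity $\langle 1\rangle$. $\mathbb{C}[G]$ is the complex group ring, with multiplicative identity $1=\langle 1\rangle$; $E=\frac{1}{q^w}\sum_{\gamma\in G}\gamma\in\mathbb{C}[G]$ and $J=1-E$. The $u_i$ ($i\in T$) and $z$ are commuting indeterminates, and $1/(1-\langle g\rangle z^iu_i)$ is the geometric series $\sum_{k\ge0}\langle g\rangle^kz^{ik}u_i^k$. For a formal power series over $\mathbb{C}[G]$ in these indeterminates, $[\langle f\rangle z^m\prod_{i\in T}u_i^{l_i}]$ denotes the complex coefficient of the group element $\langle f\rangle$ in the coefficient (in $\mathbb{C}[G]$) of $z^m\prod_{i\in T}u_i^{l_i}$. The number of monic irreducible factors of $g$ of degree $i$ counted with multiplicity is $\sum_{h\in I_i}\max\{k:h^k\mid g\}$. An empty sum is $0$, an empty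 product is $1$, and $\mathbf{1}[P]$ is $1$ if $P$ is true and $0$ otherwise. *)

(* Defs.v *)
From HB Require Import structures.
From mathcomp Require Import all_boot all_order all_fingroup all_algebra.
From mathcomp Require Import finmap boolp functions reals complex.

Set Implicit Arguments.
Unset Strict Implicit.
Unset Printing Implicit Defensive.

Import GRing.Theory.
Local Open Scope ring_scope.

Section Polynomials.
Variable F : finFieldType.

(* The bounded-size polynomials {poly_d.+1 F} serve only to make the sets
   below finite. *)
Definition monics (d : nat) : {set {poly_d.+1 F}} :=
  [set f : {poly_d.+1 F} | (val f \is monic) && (size (val f) == d.+1)].

Definition monic_irr (i : nat) : {set {poly_i.+1 F}} :=
  [set h in monics i | irreducibleb (val h)].

Lemma monicsP d (f : {poly_d.+1 F}) :
  reflect (val f \is monic /\ size (val f) = d.+1) (f \in monics d).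
Proof. by rewrite inE; apply: (iffP andP) => -[? /eqP]. Qed.

Lemma monic_irrP i (h : {poly_i.+1 F}) :
  reflect [/\ val h \is monic, size (val h) = i.+1 & irreducible_poly (val h)]
    (h \in monic_irr i).
Proof.
rewrite inE; apply: (iffP andP) => [[/monicsP[hm sh] /irreducibleP hi]|[hm sh hi]].
  by [].
by split; [apply/monicsP | apply/irreducibleP].
Qed.

(* For nonconstant h and nonzero g every k with h ^+ k %| g is smaller than
   size g. *)
Definition multiplicity (h g : {poly F}) : nat :=
  \max_(k < size g | h ^+ k %| g) k.

Definition nb_irr_factors (i : nat) (g : {poly F}) : nat :=
  \sum_(h in monic_irr i) multiplicity (val h) g.

(* 'X^d * f(1/'X), for d the degree of f *)
Definition revp (f : {poly F}) : {poly F} :=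
  \poly_(j < size f) f`_((size f).-1 - j).

Definition rev_class (w : nat) (f : {poly F}) : {poly %/ 'X^(w.+1) : {poly F}} :=
  in_qpoly 'X^(w.+1) (revp f).

Definition is_class (w : nat) (x : {poly %/ 'X^(w.+1) : {poly F}}) : bool :=
  `[< exists2 f : {poly F}, f \is monic & x = rev_class w f >].

Let rev d (p : {poly F}) : {poly F} := \poly_(j < d.+1) p`_(d - j).

Let revE f : f != 0 -> revp f = rev (size f).-1 f.
Proof. by rewrite /revp /rev -size_poly_gt0 => /prednK ->. Qed.

Let rev_sum d n (c : nat -> F) (q : nat -> {poly F}) :
  rev d (\sum_(i < n) c i *: q i) = \sum_(i < n) c i *: rev d (q i).
Proof.
apply/polyP => j; rewrite coef_poly !coef_sum.
case: ltnP => jd; last first.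
  by rewrite big1 // => i _; rewrite coefZ coef_poly ltnNge jd /= mulr0.
by apply: eq_bigr => i _; rewrite !coefZ coef_poly jd.
Qed.

Let revXn d k : (k <= d)%N -> rev d 'X^k = 'X^(d - k).
Proof.
move=> kd; apply/polyP => j; rewrite coef_poly !coefXn.
case: ltnP => [jd|dj]; last first.
  by case: eqP dj => // ->; rewrite ltnNge leq_subr.
by congr ((nat_of_bool _)%:R); apply/eqP/eqP; move: jd; rewrite ltnS => jd H;
  [rewrite -H subKn | rewrite H subKn].
Qed.

Let rev_def d p : rev d p = \sum_(i < d.+1) p`_i *: 'X^(d - i).
Proof.
rewrite /rev poly_def (reindex_inj rev_ord_inj) /=.
by apply: eq_bigr => i _; rewrite subSS subKn // -ltnS.
Qed.

Let poly_sum d (p : {poly F}) :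
  (size p <= d.+1)%N -> p = \sum_(i < d.+1) p`_i *: 'X^i.
Proof.
move=> sp; rewrite -poly_def; apply/polyP => i; rewrite coef_poly.
by case: ltnP => // di; rewrite nth_default // (leq_trans sp).
Qed.

Let revM d e (f g : {poly F}) : (size f <= d.+1)%N -> (size g <= e.+1)%N ->
  rev (d + e) (f * g) = rev d f * rev e g.
Proof.
move=> sf sg; rewrite [rev d f]rev_def big_distrl /=.
have -> : f * g = \sum_(i < d.+1) f`_i *: ('X^i * g).
  rewrite {1}(poly_sum sf) big_distrl; apply: eq_bigr => i _.
  by rewrite scalerAl.
rewrite (rev_sum _ _ (fun i => f`_i) (fun i => 'X^i * g)).
apply: eq_bigr => i _; rewrite -scalerAl; congr (_ *: _).
rewrite (rev_def e) big_distrr /= {1}(poly_sum sg) big_distrr /=.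
under eq_bigr => k _ do rewrite -scalerAr -exprD.
etransitivity; first exact: (rev_sum _ _ _ (fun k => 'X^(i + k))).
apply: eq_bigr => k _; have [ki kk] := (ltn_ord i, ltn_ord k).
rewrite ltnS in ki; rewrite ltnS in kk.
rewrite -scalerAr -exprD revXn ?leq_add //.
by rewrite addnBA // addnBAC // subnDA.
Qed.

Lemma revpM (f g : {poly F}) : f \is monic -> g \is monic ->
  revp (f * g) = revp f * revp g.
Proof.
move=> fm gm; have [f0 g0] := (monic_neq0 fm, monic_neq0 gm).
have fg0 : f * g != 0 by rewrite mulf_neq0.
have sf : (size f).-1.+1 = size f by rewrite prednK // size_poly_gt0.
have sg : (size g).-1.+1 = size g by rewrite prednK // size_poly_gt0.
rewrite (revE f0) (revE g0) (revE fg0) -revM ?sf ?sg //; congr (rev _ _).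
by rewrite size_mul // -sf -sg addSn addnS.
Qed.

Lemma revp1 : revp 1 = 1.
Proof.
by apply/polyP => -[|j]; rewrite coef_poly size_poly1 !coef1.
Qed.

Variable w : nat.
Local Notation Q := {poly %/ 'X^(w.+1) : {poly F}}.

Lemma rev_classM (f g : {poly F}) : f \is monic -> g \is monic ->
  rev_class w (f * g) = rev_class w f * rev_class w g.
Proof. by move=> fm gm; rewrite /rev_class revpM // in_qpolyM. Qed.

Let in_qpolyE (p : {poly F}) : in_qpoly 'X^(w.+1) p = p %% 'X^(w.+1) :> {poly F}.
Proof. by rewrite /= mk_monic_Xn Pdiv.IdomainMonic.modpE ?monicXn. Qed.

Let coef0_mod (p : {poly F}) : (p %% 'X^(w.+1))`_0 = p`_0.
Proof. by rewrite [in RHS](divp_eq p 'X^(w.+1)) coefD coefMXn add0r. Qed.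

Let coef0_mul (x y : Q) : ((x * y : Q) : {poly F})`_0 = (x : {poly F})`_0 * (y : {poly F})`_0.
Proof.
by rewrite poly_of_qpolyM -[Pdiv.CommonRing.rmodp _ _]/(in_qpoly _ _ : {poly F}) in_qpolyE
  coef0_mod coef0M.
Qed.

Lemma is_classE (x : Q) : is_class x = ((x : {poly F})`_0 == 1).
Proof.
apply/asboolP/eqP => [[f fm ->]|x0].
  rewrite in_qpolyE coef0_mod coef_poly size_poly_gt0 monic_neq0 // subn0.
  exact/eqP.
have sx : (size (x : {poly F}) <= w.+1)%N.
  apply: leq_trans (size_npoly x) _.
  by rewrite mk_monic_Xn size_polyXn.
have cf : (rev w (x : {poly F}))`_w = 1 by rewrite coef_poly ltnS leqnn subnn.
have sf : size (rev w (x : {poly F})) = w.+1.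
  by apply: size_poly_eq; rewrite subnn x0 oner_neq0.
exists (rev w (x : {poly F})); first by rewrite monicE /lead_coef sf cf.
apply: val_inj; rewrite -[RHS]/(in_qpoly _ _ : {poly F}) in_qpolyE revE ?sf /=; last first.
  by rewrite -size_poly_gt0 sf.
have -> : rev w (rev w (x : {poly F})) = x :> {poly F}.
  apply/polyP => j; rewrite coef_poly ltnS.
  case: leqP => jw; last by rewrite nth_default //; apply: leq_trans sx jw.
  by rewrite coef_poly ltnS leq_subr subKn.
by rewrite modp_small // size_polyXn; apply: sx.
Qed.

Lemma is_class_rev_class f : f \is monic -> is_class (rev_class w f).
Proof. by move=> fm; apply/asboolP; exists f. Qed.

Lemma is_class1 : is_class (1 : Q).
Proof.
by apply/asboolP; exists 1; rewrite ?monic1 // /rev_class revp1 in_qpoly1.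
Qed.

Lemma is_classM (x y : Q) : is_class x -> is_class y -> is_class (x * y).
Proof.
move=> /asboolP[f fm ->] /asboolP[g gm ->]; apply/asboolP.
by exists (f * g); rewrite ?monicMr // rev_classM.
Qed.

Lemma is_class_unit (x : Q) : is_class x -> x^-1 * x = 1.
Proof.
rewrite is_classE => /eqP x0; apply: qpoly_mulVz.
have cop (p : {poly F}) : p`_0 = 1 -> coprimep 'X^(w.+1) p.
  move=> p0; rewrite coprimep_expl // coprimep_sym -['X]subr0 -polyC0 coprimep_XsubC.
  by rewrite /root horner_coef0 p0 oner_neq0.
by rewrite [X in coprimep X _]mk_monic_Xn; apply: cop.
Qed.

Lemma is_classV (x : Q) : is_class x -> is_class x^-1.
Proof.
move=> xG; have := congr1 (fun y : Q => (y : {poly F})`_0) (is_class_unit xG).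
rewrite /= coef0_mul; have := xG; rewrite !is_classE => /eqP ->.
by rewrite mulr1 => -> /=; rewrite coef1.
Qed.

Definition class_group : Type := {x : Q | is_class x}.
HB.instance Definition _ := SubType.on class_group.
HB.instance Definition _ := [Finite of class_group by <:].

Definition class_mul (x y : class_group) : class_group :=
  Sub (val x * val y) (is_classM (valP x) (valP y)).
Definition class_one : class_group := Sub 1 is_class1.
Definition class_inv (x : class_group) : class_group :=
  Sub (val x)^-1 (is_classV (valP x)).

Fact class_mulA : associative class_mul.
Proof. by move=> x y z; apply: val_inj; rewrite /= mulrA. Qed.
Fact class_mul1 : left_id class_one class_mul.
Proof. by move=> x; apply: val_inj; rewrite /= mul1r. Qed.
Fact class_mulV : left_inverse class_one class_inv class_mul.
Proof. by move=> x; apply: val_inj; rewrite /= is_class_unit // (valP x). Qed.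

HB.instance Definition _ :=
  Finite_isGroup.Build class_group class_mulA class_mul1 class_mulV.

Lemma class_mulC : commutative (@mulg class_group).
Proof. by move=> x y; apply: val_inj; rewrite /= mulrC. Qed.

End Polynomials.

Section ShortClass.
Variables (F : finFieldType) (w : nat).

(* The default value of insubd is irrelevant: the class of a monic polynomial
   always satisfies is_class. *)
Definition short_class (f : {poly F}) : class_group F w :=
  insubd (class_one F w) (rev_class w f).

Lemma val_short_class f : f \is monic -> val (short_class f) = rev_class w f.
Proof. by move=> fm; rewrite val_insubd is_class_rev_class. Qed.

Lemma short_classM f g : f \is monic -> g \is monic ->
  short_class (f * g) = (short_class f * short_class g)%g.
Proof.
move=> fm gm; apply: val_inj => /=.
by rewrite !val_short_class ?monicMr // rev_classM.
Qed.

Lemma short_class1 : short_class 1 = 1%g.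
Proof.
by apply: val_inj; rewrite val_short_class ?monic1 // /rev_class revp1 in_qpoly1.
Qed.

Lemma short_class_surj (x : class_group F w) :
  exists2 f : {poly F}, f \is monic & x = short_class f.
Proof.
have /asboolP[f fm xf] := valP x; exists f => //.
by apply: val_inj; rewrite val_short_class.
Qed.

End ShortClass.

Section GroupRing.
Variables (C : comNzRingType) (F : finFieldType) (w : nat).
Local Notation G := (class_group F w).

Definition group_ring : Type := {ffun G -> C}.

HB.instance Definition _ := GRing.Lmodule.copy group_ring {ffun G -> C^o}.

Definition gr_elt (x : G) : group_ring := [ffun y : G => (y == x)%:R].

Definition gr_mul (a b : group_ring) : group_ring :=
  [ffun x : G => \sum_(y : G) a y * b (y^-1 * x)%g].

Fact gr_mulA : associative gr_mul.
Proof.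
move=> a b c; apply/ffunP => x; rewrite !ffunE.
under eq_bigr => y _ do rewrite ffunE big_distrr /=.
under [RHS]eq_bigr => y _ do rewrite ffunE big_distrl /=.
rewrite [RHS]exchange_big /=; apply: eq_bigr => y _.
rewrite (reindex_inj (mulgI y^-1%g)) /=; apply: eq_bigr => z _.
by rewrite mulrA invMg invgK -!mulgA mulKVg.
Qed.

Fact gr_mulC : commutative gr_mul.
Proof.
move=> a b; apply/ffunP => x; rewrite !ffunE.
have inj : injective (fun y : G => (x * y^-1)%g).
  by move=> y z /mulgI /invg_inj.
rewrite (reindex_inj inj) /=; apply: eq_bigr => y _.
by rewrite mulrC invMg invgK mulgKV class_mulC.
Qed.

Fact gr_mul1 : left_id (gr_elt 1%g) gr_mul.
Proof.
move=> a; apply/ffunP => x; rewrite ffunE (bigD1 1%g) //= ffunE eqxx mul1r.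
rewrite invg1 mul1g big1 ?addr0 // => y /negPf y1.
by rewrite ffunE y1 mul0r.
Qed.

Fact gr_mulD : left_distributive gr_mul +%R.
Proof.
move=> a b c; apply/ffunP => x; rewrite !ffunE -big_split /=.
by apply: eq_bigr => y _; rewrite ffunE mulrDl.
Qed.

Fact gr_1_neq0 : gr_elt 1%g != 0 :> group_ring.
Proof.
by apply/eqP => /ffunP/(_ 1%g)/eqP; rewrite !ffunE eqxx oner_eq0.
Qed.

HB.instance Definition _ := GRing.Zmodule_isComNzRing.Build group_ring
  gr_mulA gr_mulC gr_mul1 gr_mulD gr_1_neq0.

Lemma gr_eltM (x y : G) : gr_elt (x * y)%g = gr_elt x * gr_elt y.
Proof.
apply/ffunP => z; rewrite !ffunE (bigD1 x) //= !ffunE eqxx mul1r big1.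
  by rewrite addr0; congr ((nat_of_bool _)%:R); apply/eqP/eqP => [->|<-];
    rewrite ?mulKg ?mulKVg.
by move=> u /negPf ux; rewrite ffunE ux mul0r.
Qed.

End GroupRing.

Section PowerSeries.
Variables (I : finType) (A : comNzRingType).

(* Formal power series over A in indeterminates indexed by I, as coefficient
   functions on exponents. *)
Definition power_series : Type := {ffun I -> nat} -> A.
Implicit Types (n : {ffun I -> nat}) (a b c : power_series).

HB.instance Definition _ := GRing.Zmodule.on power_series.

Definition ps_mul a b : power_series := fun n =>
  \sum_(k : {dffun forall i : I, 'I_(n i).+1})
    a [ffun i => k i : nat] * b [ffun i => n i - k i]%N.

Definition ps_const (x : A) : power_series := fun n => if n == 0 then x else 0.

Definition ps_var (i : I) : power_series :=
  fun n => (n == [ffun j => (j == i) : nat])%:R.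

Let nv N (k : {ffun I -> 'I_N}) : {ffun I -> nat} := [ffun i => k i : nat].

Let ps_mulE N a b n : (forall i, n i < N)%N ->
  ps_mul a b n = \sum_(k : {ffun I -> 'I_N}) \sum_(l : {ffun I -> 'I_N} |
     nv k + nv l == n) a (nv k) * b (nv l).
Proof.
move=> nN; rewrite pair_big_dep /=.
pose h (k : {dffun forall i : I, 'I_(n i).+1}) :
    {ffun I -> 'I_N} * {ffun I -> 'I_N} :=
  ([ffun i => Ordinal (leq_ltn_trans (leq_ord (k i)) (nN i))],
   [ffun i => Ordinal (leq_ltn_trans (leq_subr (k i) (n i)) (nN i))]).
pose h' (p : {ffun I -> 'I_N} * {ffun I -> 'I_N}) :
    {dffun forall i : I, 'I_(n i).+1} :=
  [ffun i => inord (p.1 i) : 'I_(n i).+1].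
have hP k : nv (h k).1 + nv (h k).2 == n.
  by apply/eqP/ffunP => i; rewrite !ffunE /= natrDE subnKC // leq_ord.
rewrite (reindex_onto h h') /=; last first.
  move=> [k l] /= /eqP/ffunP kln.
  have kn i : (k i <= n i)%N by rewrite -kln !ffunE leq_addr.
  congr pair; apply/ffunP => i; apply: val_inj; rewrite !ffunE /= ?ffunE inordK ?ltnS //.
  by rewrite -kln !ffunE /= natrDE addKn.
rewrite [RHS](eq_bigl xpredT) => [|k]; last first.
  rewrite hP /=; apply/eqP/ffunP => i.
  by apply: val_inj; rewrite !ffunE /= inordK // ltn_ord.
apply: eq_bigr => k _; congr (a _ * b _); apply/ffunP => i; rewrite !ffunE //.
Qed.

Let deg n : nat := (\sum_i n i)%N.

Let deg_ge n i : (n i < (deg n).+1)%N.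
Proof. by rewrite ltnS /deg (bigD1 i) //= leq_addr. Qed.

Let nv_lt N (k : {ffun I -> 'I_N}) i : (nv k i < N)%N.
Proof. by rewrite ffunE. Qed.

Let collapse N n (k l s : {ffun I -> 'I_N.+1}) (x : A) :
    (forall i, n i < N.+1)%N ->
  \sum_(r : {ffun I -> 'I_N.+1} | (nv k + nv r == n) && (nv l + nv s == nv r)) x
    = if nv k + (nv l + nv s) == n then x else 0.
Proof.
move=> nN; case: eqP => [kls|kls]; last first.
  by rewrite big_pred0 // => r; apply/negP => /andP[/eqP kr /eqP lsr];
     apply: kls; rewrite lsr.
pose r0 : {ffun I -> 'I_N.+1} := [ffun i => inord (l i + s i)].
have r0E : nv r0 = nv l + nv s.
  apply/ffunP => i; rewrite !ffunE inordK // -natrDE.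
  apply: leq_ltn_trans (nN i); rewrite -kls !ffunE.
  exact: leq_addl.
rewrite (big_pred1 r0) // => r; apply/andP/eqP => [[_ /eqP lsr]|->]; last first.
  by rewrite r0E kls.
apply/ffunP => i; apply: val_inj.
by have /ffunP/(_ i) := etrans r0E lsr; rewrite !ffunE.
Qed.

Fact ps_mulC : commutative ps_mul.
Proof.
move=> a b; apply/funext => n.
rewrite !(@ps_mulE (deg n).+1) //; try exact: deg_ge.
rewrite (exchange_big_dep xpredT) //=; apply: eq_bigr => k _.
by apply: eq_big => l; [rewrite addrC | rewrite mulrC].
Qed.

Fact ps_mulA : associative ps_mul.
Proof.
move=> a b c; apply/funext => n; have nN := deg_ge n.
rewrite !(ps_mulE _ _ nN) [RHS](exchange_big_dep xpredT) //=.
under eq_bigr => k _ do under eq_bigr => r _ do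
  rewrite (ps_mulE _ _ (nv_lt r)) big_distrr /=.
under [RHS]eq_bigr => k _ do under eq_bigr => r _ do
  rewrite (ps_mulE _ _ (nv_lt r)) big_distrl /=.
under eq_bigr => k _.
  rewrite exchange_big /=.
  under eq_bigr => l _.
    under eq_bigr => r _ do rewrite big_distrr /=.
    rewrite (exchange_big_dep xpredT) //=.
    under eq_bigr => s _ do rewrite collapse //.
    over.
  over.
under [RHS]eq_bigr => s _.
  rewrite exchange_big /=.
  under eq_bigr => k _.
    under eq_bigr => r _ do rewrite big_distrl /=.
    rewrite (exchange_big_dep xpredT) //=.
    under eq_bigr => l _.
      under eq_bigl => r do rewrite [nv r + nv s]addrC.
      rewrite collapse //.
      over.
    over.
  over.
rewrite [RHS]exchange_big /=; apply: eq_bigr => k _.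
rewrite [RHS]exchange_big /=; apply: eq_bigr => l _.
apply: eq_bigr => s _.
by rewrite mulrA addrA [nv s + _]addrC.
Qed.

Fact ps_mul1 : left_id (ps_const 1) ps_mul.
Proof.
move=> a; apply/funext => n; rewrite /ps_mul.
pose k0 : {dffun forall i : I, 'I_(n i).+1} := [ffun i => ord0].
rewrite (bigD1 k0) //= big1 ?addr0 => [|k kk0].
  rewrite /ps_const ifT ?mul1r; last by apply/eqP/ffunP => i; rewrite !ffunE.
  by congr (a _); apply/ffunP => i; rewrite !ffunE subn0.
rewrite /ps_const ifF ?mul0r //; apply/negbTE; apply: contra kk0.
move=> /eqP/ffunP k0E; apply/eqP/ffunP => i; apply: val_inj.
by have := k0E i; rewrite !ffunE.
Qed.

Fact ps_mulD : left_distributive ps_mul +%R.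
Proof.
move=> a b c; apply/funext => n; rewrite -[RHS]/(ps_mul a c n + ps_mul b c n).
rewrite /ps_mul -big_split /=; apply: eq_bigr => k _.
by rewrite -mulrDl.
Qed.

Fact ps_1_neq0 : ps_const 1 != 0 :> power_series.
Proof.
apply/eqP => /(congr1 (fun a : power_series => a 0)).
by rewrite /ps_const eqxx => /eqP; rewrite oner_eq0.
Qed.

HB.instance Definition _ := GRing.Zmodule_isComNzRing.Build power_series
  ps_mulA ps_mulC ps_mul1 ps_mulD ps_1_neq0.

(* 1 / (1 - a) = \sum_(k >= 0) a ^+ k for a without constant term: then a ^+ k
   has no term of total degree less than k, so that for each coefficient the sum
   may be cut off at the total degree of the exponent. *)
Definition ps_geom a : power_series :=
  fun n => \sum_(k < (\sum_i n i).+1) (a ^+ k) n.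

Let ps_sum n (J : Type) (r : seq J) (P : pred J) (G : J -> power_series) :
  (\sum_(j <- r | P j) G j) n = \sum_(j <- r | P j) G j n.
Proof. exact: (big_morph (fun a : power_series => a n)). Qed.

Let ps_exp_low a k n : a 0 = 0 -> (deg n < k)%N -> (a ^+ k) n = 0.
Proof.
move=> a0; elim: k n => // k IH n nk; rewrite exprS.
rewrite -[LHS]/(ps_mul _ _ _) /ps_mul big1 // => l _.
have [l0|l0] := eqVneq [ffun i => l i : nat] 0; first by rewrite l0 a0 mul0r.
rewrite [X in _ * X]IH ?mulr0 // -ltnS; apply: leq_trans nk.
rewrite ltnS /deg.
have -> : (\sum_i n i = \sum_i l i + \sum_i (n i - l i))%N.
  by rewrite -big_split; apply: eq_bigr => i _ /=; rewrite subnKC // leq_ord.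
under eq_bigr => i _ do rewrite ffunE.
rewrite -[X in (X < _)%N]add0n ltn_add2r lt0n sum_nat_eq0.
apply: contra l0 => /forallP l0; apply/eqP/ffunP => i; rewrite !ffunE.
by have /eqP := l0 i.
Qed.

Lemma ps_geomE a : a 0 = 0 -> (1 - a) * ps_geom a = 1.
Proof.
move=> a0.
have geomS n N : (deg n < N)%N -> ps_geom a n = (\sum_(k < N) a ^+ k) n.
  move=> nN; rewrite ps_sum /ps_geom -/(deg n).
  rewrite -(subnKC nN) big_split_ord /= [X in _ + X]big1 ?addr0 // => k _.
  by rewrite ps_exp_low // addSn ltnS leq_addr.
apply/funext => n; pose S := \sum_(k < (deg n).+1) a ^+ k.
have -> : ((1 - a) * ps_geom a) n = ((1 - a) * S) n.
  rewrite -[LHS]/(ps_mul _ _ _) -[RHS]/(ps_mul _ _ _); apply: eq_bigr => k _.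
  congr (_ * _); apply: geomS; rewrite ltnS; apply: leq_sum => i _.
  by rewrite ffunE leq_subr.
have -> : (1 - a) * S = 1 - a ^+ (deg n).+1.
  by rewrite -opprB mulNr -subrX1 opprB.
by rewrite -[LHS]/((1 : power_series) n - (a ^+ _) n) ps_exp_low // subr0.
Qed.

End PowerSeries.

Arguments ps_const I {A} x.
Arguments ps_var {I} A i.

Section Counting.
Variables (F : finFieldType) (w m : nat) (T : {fset nat}) (l : T -> nat).

Definition nb_star (f : {poly F}) : nat :=
  #|[set g in monics F m | (short_class w (val g) == short_class w f) &&
       [forall i : T, nb_irr_factors (val i) (val g) == l i]]|.

Variable C : fieldType.
Local Notation CG := (group_ring C F w).

Definition gr_avg : CG :=
  (#|F|%:R ^- w : C) *: \sum_(x : class_group F w) gr_elt C x.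

Definition gr_coavg : CG := 1 - gr_avg.

Local Notation PS := (power_series (option T) CG).

(* The indeterminates are indexed by option T: None for z, Some i for u_i. *)
Definition ps_z : PS := ps_var CG None.
Definition ps_u (i : T) : PS := ps_var CG (Some i).

Definition class_term (h : {poly F}) (d : nat) : PS :=
  ps_const (option T) (gr_elt C (short_class w h)) * ps_z ^+ d.

Lemma class_geomE (h : {poly F}) (d : nat) (i : T) :
  (1 - class_term h d * ps_u i) * ps_geom (class_term h d * ps_u i) = 1.
Proof.
apply: ps_geomE; rewrite -[LHS]/(ps_mul _ _ _) /ps_mul big1 // => k _.
rewrite [X in _ * X](_ : _ = 0) ?mulr0 // /ps_u /ps_var.
case: eqP => // /ffunP /(_ (Some i)); rewrite ffunE.
have n0 : (0%R : {ffun option T -> nat}) (Some i) = 0%N by rewrite ffunE.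
have : ((0%R : {ffun option T -> nat}) (Some i) - k (Some i) <= 0)%N.
  by apply: leq_trans (leq_subr _ _) _; rewrite n0.
by rewrite leqn0 => /eqP ->; rewrite ffunE eqxx.
Qed.

Definition star_series : PS :=
  ps_const (option T) gr_coavg
  * (\sum_(d < w) \sum_(h in monics F d) class_term (val h) d)
  * \prod_(i : T) \prod_(g in monic_irr F (val i))
      ((1 - class_term (val g) (val i))
       * ps_geom (class_term (val g) (val i) * ps_u i)).

Definition star_exponent : {ffun option T -> nat} :=
  [ffun o => if o is Some i then l i else m].

End Counting.

Arguments gr_avg F w C : clear implicits.
Arguments gr_coavg F w C : clear implicits.
Arguments ps_z F w T C : clear implicits.
Arguments ps_u F w {T} C i.
Arguments class_term {F} w T C h d.
Arguments star_series F w T C : clear implicits.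

(* Main.v *)
(* Let S be the series of all <g> z^(deg g) prod_i u_i^(l_i(g)), g monic, where
   l_i(g) counts the irreducible factors of degree i, and let S0 be S at u = 1.
   For an irreducible h, multiplying a series of this kind by 1 - <h> X^k, where
   X^k is the monomial of h, leaves the terms with h not dividing g; these do not
   depend on the variable that h is counted by.  Doing this for every h of degree
   in T, one gets S = S0 prod_i prod_h (1 - <h> z^i) / (1 - <h> z^i u_i).
   For d >= w each class contains q^(d-w) monic polynomials of degree d, and
   E a = aug(a) E for the augmentation aug, so that
   S0 = J sum_(d < w) sum_(h in M_d) <h> z^d + E / (1 - q z).
   In the E part every <h> may be replaced by 1, and the coefficient of the
   resulting scalar series is read off from the binomial expansions of
   (1 - z^i)^N and (1 - z^i u_i)^(-N), with N = |I_i|. *)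
Require Import Defs.
From HB Require Import structures.
From mathcomp Require Import all_boot all_order all_fingroup all_algebra.
From mathcomp Require Import finmap boolp functions reals complex.

Set Implicit Arguments.
Unset Strict Implicit.
Unset Printing Implicit Defensive.

Import GRing.Theory.
Local Open Scope ring_scope.

(** * Multiplicities, and monic multiples of a fixed polynomial *)

Section Polynomials.
Variable F : finFieldType.
Implicit Types (f g h : {poly F}).

(** The exponents [k] with [h ^+ k %| g] are closed downwards and, as [h] is nonconstant, all lie
    below [size g]; so the bounded maximum defining [multiplicity] misses none of them. *)
Lemma dvdp_exp_multiplicity h g k : (1 < size h)%N -> g != 0 ->
  (h ^+ k %| g) = (k <= multiplicity h g)%N.
Proof.
move=> sh g0; apply/idP/idP => [hkg|].
  have kg : (k < size g)%N.
    apply: leq_trans (dvdp_leq g0 hkg).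
    have h0 : h != 0 by rewrite -size_poly_gt0 ltnW.
    rewrite -[X in (_ < X)%N]prednK ?size_poly_gt0 ?expf_neq0 //.
    by rewrite size_exp ltnS leq_pmull // -subn1 subn_gt0.
  exact: (@leq_bigmax_cond _ (fun i : 'I__ => h ^+ i %| g) (fun i => i)
            (Ordinal kg)).
move=> km; apply: dvdp_trans (dvdp_exp2l h km) _.
by rewrite /multiplicity; elim/big_ind: _ => // [|x y hx hy];
  [rewrite expr0 dvd1p | case: leqP].
Qed.

Lemma multiplicity_eq0 h g : (1 < size h)%N -> g != 0 -> ~~ (h %| g) ->
  multiplicity h g = 0.
Proof.
move=> sh g0; rewrite -[h in h %| _]expr1 dvdp_exp_multiplicity //.
by rewrite -leqNgt leqn0 => /eqP.
Qed.

Lemma multiplicityMl h g : (1 < size h)%N -> g != 0 ->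
  multiplicity h (h * g) = (multiplicity h g).+1.
Proof.
move=> sh g0; have h0 : h != 0 by rewrite -size_poly_gt0 ltnW.
have hg0 : h * g != 0 by rewrite mulf_neq0.
have key k : (k <= multiplicity h (h * g) -> k <= (multiplicity h g).+1)%N.
  case: k => // k; rewrite -dvdp_exp_multiplicity // exprS dvdp_mul2l //.
  by rewrite dvdp_exp_multiplicity.
apply/eqP; rewrite eqn_leq key //=.
by rewrite -dvdp_exp_multiplicity // exprS dvdp_mul2l // dvdp_exp_multiplicity.
Qed.

Lemma multiplicityM_coprime h h' g : (1 < size h')%N -> h * g != 0 ->
  coprimep h' h -> multiplicity h' (h * g) = multiplicity h' g.
Proof.
move=> sh' hg0 coph; have /andP[h0 g0] : (h != 0) && (g != 0).
  by rewrite -negb_or -mulf_eq0.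
have keyE k : (k <= multiplicity h' (h * g) = (k <= multiplicity h' g))%N.
  by rewrite -!dvdp_exp_multiplicity // Gauss_dvdpr // coprimep_expl.
by apply/eqP; rewrite eqn_leq keyE leqnn -keyE leqnn.
Qed.

Lemma irreducible_monic_coprime h h' : irreducible_poly h -> irreducible_poly h' ->
  h \is monic -> h' \is monic -> h != h' -> coprimep h h'.
Proof.
move=> ih ih' hm hm' hh'; rewrite irreducible_poly_coprime //.
apply: contra hh' => /ih'.2 hh'; rewrite -eqp_monic //; apply: hh'.
by apply: contraTneq ih.1 => ->.
Qed.

(** Inverse of [val] on polynomials of size at most [n]; the default 0 is reached only for larger
    ones. *)
Definition npoly_of (n : nat) (g : {poly F}) : {poly_n F} := insubd (0 : {poly_n F}) g.

Lemma val_npoly_of n g : (size g <= n)%N -> val (npoly_of n g) = g.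
Proof. by move=> sg; rewrite val_insubd; case: ifP => //; rewrite qualifE /= sg. Qed.

Lemma npoly_of_val n (g : {poly_n F}) : npoly_of n (val g) = g.
Proof. by apply: val_inj; rewrite val_npoly_of // size_npoly. Qed.

(** Multiplication and division by [h] are inverse bijections between the two index sets. The
    summand [H] takes plain polynomials because the two sums range over different bounded-size
    types. *)
Lemma big_monics_dvd (V : nmodType) h d (H : {poly F} -> V) : h \is monic ->
  \sum_(g in monics F d | h %| val g) H (val g)
    = if ((size h).-1 <= d)%N then
        \sum_(g in monics F (d - (size h).-1)) H (h * val g)
      else 0.
Proof.
move=> hm; have h0 := monic_neq0 hm.
have [e sh] : exists e, size h = e.+1.
  by exists (size h).-1; rewrite prednK // size_poly_gt0.
rewrite sh /=.
case: ifP => [hd|hd]; last first.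
  rewrite big_pred0 // => g; apply/negP => /andP[/monicsP[gm sg] /dvdp_leq].
  by rewrite sg sh ltnS hd monic_neq0 // => /(_ isT).
have szle (g : {poly_(d - e).+1 F}) : (size (h * val g)%R <= d.+1)%N.
  apply: leq_trans (size_polyMleq _ _) _; rewrite sh addSn /=.
  apply: leq_trans (leq_add (leqnn e) (size_npoly g)) _.
  by rewrite addnS subnKC.
rewrite (reindex_onto
  (fun g : {poly_(d - e).+1 F} => npoly_of d.+1 (h * val g))
  (fun g : {poly_d.+1 F} => npoly_of (d - e).+1 (val g %/ h))) /=; last first.
  move=> g /andP[/monicsP[gm sg] hg]; apply: val_inj.
  have sgh : size (val g %/ h) = (d - e).+1.
    by rewrite size_divp // sg sh subSn.
  by rewrite (@val_npoly_of _ (_ %/ _)) ?sgh // mulrC divpK // val_npoly_of ?sg.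
apply: eq_big => [g|g _]; last by rewrite val_npoly_of ?(szle g).
have valE : val (npoly_of d.+1 (h * g)) = h * g by rewrite val_npoly_of ?(szle g).
rewrite [X in h %| X]valE [X in X %/ h]valE [X in X %/ h]mulrC mulpK //.
rewrite npoly_of_val eqxx andbT dvdp_mulIl andbT.
apply/monicsP/monicsP; rewrite valE monicMl //= => -[gm sg]; split=> //.
  move: sg; rewrite size_mul // ?monic_neq0 // sh addSn /= => eg.
  by rewrite -[LHS](addKn e) eg subSn.
by rewrite size_mul ?monic_neq0 // sg sh addSn /= addnS subnKC.
Qed.

End Polynomials.

(** * Counting the monic polynomials of given degree in a class *)

Section Classes.
Variables (F : finFieldType) (w : nat).
Implicit Types (f g : {poly F}).

Lemma rev_classE f : rev_class w f = take_poly w.+1 (revp f) :> {poly F}.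
Proof.
rewrite Pdiv.IdomainMonic.take_poly_modp /rev_class /=.
by rewrite mk_monic_Xn Pdiv.IdomainMonic.modpE ?monicXn.
Qed.

Lemma short_class_eqP f g : f \is monic -> g \is monic ->
  reflect (forall j, (j <= w)%N -> (revp f)`_j = (revp g)`_j)
    (short_class w f == short_class w g).
Proof.
move=> fm gm; rewrite -val_eqE !val_short_class //; apply: (iffP eqP) => [fg j jw|fg].
  have : (rev_class w f : {poly F})`_j = (rev_class w g : {poly F})`_j.
    by rewrite fg.
  by rewrite !rev_classE !coef_take_poly ltnS jw.
apply: val_inj; rewrite [LHS]rev_classE [RHS]rev_classE; apply/polyP => j.
by rewrite !coef_take_poly ltnS; case: ifP => // /fg.
Qed.

Lemma coef_revp f d j : size f = d.+1 -> (j <= d)%N -> (revp f)`_j = f`_(d - j).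
Proof. by move=> sf jd; rewrite coef_poly sf ltnS jd. Qed.

(** The [w.+1] top coefficients are prescribed, consistently with monicity since [c 0 = 1]; the
    [d - w] lower ones are free and form an element of [{poly_(d - w) F}]. *)
Lemma card_monics_prefix d (c : nat -> F) : c 0 = 1 -> (w <= d)%N ->
  #|[set g in monics F d | [forall j : 'I_w.+1, (val g)`_(d - j) == c j]]|
    = (#|F| ^ (d - w))%N.
Proof.
move=> c0 wd; rewrite -card_npoly.
(* Free low part [r] below the prescribed top part: position [k] carries [c (d - k)]. *)
pose u (r : {poly_(d - w) F}) : {poly F} :=
  \poly_(k < d.+1) if (k < d - w)%N then r`_k else c (d - k)%N.
have su r : size (u r) = d.+1.
  by apply: size_poly_eq; rewrite ltnNge leq_subr subnn c0 oner_neq0.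
have vu r : val (npoly_of d.+1 (u r)) = u r by rewrite val_npoly_of ?su.
rewrite -[RHS](@card_imset _ _ (fun r => npoly_of d.+1 (u r))) => [|r s rs].
  apply: eq_card => g; rewrite inE; apply/andP/imsetP => [[/monicsP[gm sg] gc]|].
    exists (npoly_of (d - w) (take_poly (d - w) (val g))) => //.
    apply: val_inj; rewrite vu; apply/polyP => k; rewrite coef_poly.
    case: ltnP => kd; last by rewrite nth_default // sg.
    case: ltnP => kw.
      by rewrite val_npoly_of ?size_take_poly // coef_take_poly kw.
    have jw : (d - k < w.+1)%N by rewrite ltnS leq_subCl.
    by have /forallP/(_ (Ordinal jw))/eqP <- := gc; rewrite /= subKn.
  case=> r _ ->; split.
    apply/monicsP; rewrite vu; split=> //.
    rewrite monicE /lead_coef su coef_poly leqnn ltnNge leq_subr /=.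
    by rewrite subnn c0.
  apply/forallP => j; rewrite vu coef_poly ltnS leq_subr.
  have jd : (j <= d)%N by rewrite (leq_trans _ wd) // -ltnS.
  by rewrite ifF ?subKn // ltnNge leq_sub2l // -ltnS.
apply: val_inj; apply/polyP => k.
case: (ltnP k (d - w)) => kw; last by rewrite !nth_default // (leq_trans (size_npoly _)).
have := congr1 (fun g : {poly_d.+1 F} => (val g)`_k) rs.
have kd : (k < d.+1)%N by rewrite (ltn_trans kw) // ltnS leq_subr.
by rewrite /= !val_npoly_of ?su // !coef_poly kw kd.
Qed.

End Classes.

(** The case [w = 0] of the preceding count: the only prescribed coefficient is the leading one,
    which monicity fixes. *)
Lemma card_monics (F : finFieldType) d : #|monics F d| = (#|F| ^ d)%N.
Proof.
rewrite -[d in RHS]subn0 -(@card_monics_prefix F 0 d (fun=> 1)) //.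
apply: eq_card => g; rewrite [RHS]inE andb_idr // => /monicsP[gm sg].
apply/forallP => j; rewrite ord1 subn0; move: gm.
by rewrite monicE /lead_coef sg.
Qed.

(** For [w <= d] a class prescribes exactly the [w.+1] top coefficients, read off from the reversal
    of any representative [f], whatever its degree. *)
Lemma card_monics_class (F : finFieldType) w d (x : class_group F w) : (w <= d)%N ->
  #|[set g in monics F d | short_class w (val g) == x]| = (#|F| ^ (d - w))%N.
Proof.
move=> wd; have [f fm ->] := short_class_surj x.
rewrite -(@card_monics_prefix F w d (fun j => (revp f)`_j)) //; last first.
  by rewrite coef_poly size_poly_gt0 monic_neq0 // subn0; apply/eqP.
apply: eq_card => g; rewrite [LHS]inE [RHS]inE.
apply: andb_id2l => /monicsP[gm sg].
apply/short_class_eqP/forallP => // [gf j|gf j jw].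
  have jw : (j <= w)%N by rewrite -ltnS.
  by rewrite -gf // (coef_revp sg) // (leq_trans jw).
have := gf (Ordinal (jw : (j < w.+1)%N)) => /eqP /= <-.
by rewrite (coef_revp sg) // (leq_trans jw).
Qed.

(** * Monomials, truncation, and negative powers of one minus a monomial *)

Section PowerSeriesTerms.
Variables (I : finType) (A : comNzRingType).
Local Notation PS := (power_series I A).
Implicit Types (c : A) (k n : {ffun I -> nat}) (a b : PS).

(** Common normal form for constants, indeterminates and their products. *)
Definition ps_term c k : PS := fun n => if n == k then c else 0.

Lemma ps_constE c : ps_const I c = ps_term c 0.
Proof. by []. Qed.

Lemma ps_varE i : ps_var A i = ps_term 1 [ffun j => (j == i) : nat].
Proof. by apply/funext => n; rewrite /ps_var /ps_term; case: eqP. Qed.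

Lemma ps_sumE n (J : Type) (r : seq J) (P : pred J) (G : J -> PS) :
  (\sum_(j <- r | P j) G j) n = \sum_(j <- r | P j) G j n.
Proof. exact: (big_morph (fun a : PS => a n)). Qed.

(** In the convolution only the splitting of [n] into [k] and [n - k] contributes. *)
Lemma ps_termMl c k a n :
  (ps_term c k * a) n =
    if [forall i, (k i <= n i)%N] then c * a [ffun i => n i - k i]%N else 0.
Proof.
rewrite -[LHS]/(ps_mul _ _ _) /ps_mul.
case: ifPn => [/forallP kn|kn]; last first.
  rewrite big1 // => s _; rewrite /ps_term ifF ?mul0r //.
  apply: contraNF kn => /eqP/ffunP sk; apply/forallP => i.
  by rewrite -sk ffunE leq_ord.
pose k0 : {dffun forall i : I, 'I_(n i).+1} := [ffun i => inord (k i)].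
have k0E i : k0 i = k i :> nat by rewrite ffunE inordK // ltnS.
rewrite (bigD1 k0) //= big1 ?addr0 => [|s sk].
  rewrite /ps_term ifT; last by apply/eqP/ffunP => i; rewrite ffunE k0E.
  by congr (_ * a _); apply/ffunP => i; rewrite !ffunE inordK // ltnS.
rewrite /ps_term ifF ?mul0r //; apply: contraNF sk => /eqP/ffunP sk.
by apply/eqP/ffunP => i; apply: val_inj; rewrite [RHS]k0E -sk ffunE.
Qed.

Lemma ps_termM c d k n : ps_term c k * ps_term d n = ps_term (c * d) (k + n).
Proof.
apply/funext => m; rewrite ps_termMl /ps_term.
case: (m =P k + n) => [->|mkn].
  rewrite ifT; last by apply/forallP => i; rewrite !ffunE natrDE leq_addr.
  by rewrite ifT //; apply/eqP/ffunP => i; rewrite !ffunE natrDE addKn.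
case: ifPn => // /forallP km; case: eqP => [mk|]; last by rewrite mulr0.
case: mkn; apply/ffunP => i; move/ffunP/(_ i): mk.
by rewrite !ffunE natrDE => <-; rewrite subnKC.
Qed.

Lemma ps_termD c d k : ps_term (c + d) k = ps_term c k + ps_term d k.
Proof.
apply/funext => n; rewrite -[RHS]/(ps_term c k n + ps_term d k n) /ps_term.
by case: eqP => _; rewrite ?addr0.
Qed.

Lemma ps_term_sum (J : Type) (r : seq J) (P : pred J) (c : J -> A) k :
  \sum_(j <- r | P j) ps_term (c j) k = ps_term (\sum_(j <- r | P j) c j) k.
Proof.
rewrite (big_morph (fun x => ps_term x k) (id1 := 0) (op1 := +%R)) //.
  by move=> x y; rewrite ps_termD.
by apply/funext => n; rewrite /ps_term; case: eqP.
Qed.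

Lemma ps_term_prod (J : Type) (r : seq J) (P : pred J) (c : J -> A)
    (k : J -> {ffun I -> nat}) :
  \prod_(j <- r | P j) ps_term (c j) (k j)
    = ps_term (\prod_(j <- r | P j) c j) (\sum_(j <- r | P j) k j).
Proof.
by elim/big_rec3: _ => // j x y z _ ->; rewrite ps_termM.
Qed.

Lemma ps_termX c k d : ps_term c k ^+ d = ps_term (c ^+ d) (k *+ d).
Proof.
by elim: d => // d IH; rewrite !exprS IH ps_termM mulrS.
Qed.

(** Congruence modulo terms of total degree above [L]; being compatible with products, it lets
    finite sums replace geometric series. *)
Definition eq_upto (L : nat) a b : Prop :=
  forall n, (\sum_i n i <= L)%N -> a n = b n.

Lemma eq_uptoM L a a' b b' : eq_upto L a a' -> eq_upto L b b' ->
  eq_upto L (a * b) (a' * b').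
Proof.
move=> aa bb n nL; rewrite -[LHS]/(ps_mul _ _ _) -[RHS]/(ps_mul _ _ _).
apply: eq_bigr => s _; congr (_ * _); [apply: aa | apply: bb];
  by apply: leq_trans nL; apply: leq_sum => i _; rewrite ffunE ?leq_ord ?leq_subr.
Qed.

Lemma eq_upto_prod L (J : Type) (r : seq J) (P : pred J) (a b : J -> PS) :
  (forall j, eq_upto L (a j) (b j)) ->
  eq_upto L (\prod_(j <- r | P j) a j) (\prod_(j <- r | P j) b j).
Proof.
move=> ab; elim/big_rec2: _ => // j x y _ xy; exact: eq_uptoM.
Qed.

(** The negative binomial series, by induction on [N]: multiplying the sum for [N.+1] by
    [1 - ps_term 1 k] gives the sum for [N] up to truncation. *)
Lemma ps_geom_termX L k N i : k i != 0%N ->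
  eq_upto L (ps_geom (ps_term 1 k) ^+ N)
    (\sum_(j < L.+1) ps_term ('C(N + j - 1, j)%:R) (k *+ j)).
Proof.
move=> ki; elim: N => [|N IH].
  (* For [N = 0] the truncated subtraction is harmless: the binomial is 1 at [j = 0], and 'C(j - 1,
     j) = 0 for [j > 0]. *)
  rewrite expr0 big_ord_recl big1 => [|j _]; first by rewrite addr0 bin0 mulr0n.
  by rewrite /= bin_small ?lift0 ?subn1 //; apply/funext => n; rewrite /ps_term if_same.
have gE : (1 - ps_term 1 k) * ps_geom (ps_term 1 k) = 1.
  apply: ps_geomE; rewrite /ps_term; case: eqP => // /ffunP/(_ i).
  by rewrite ffunE => k0; rewrite -k0 eqxx in ki.
pose D N := \sum_(j < L.+1) ps_term ('C(N + j - 1, j)%:R) (k *+ j).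
(* Pascal's rule leaves one boundary term, of exponent [k *+ L.+1]; its total degree exceeds [L]
   because [k i] is nonzero. *)
have DS : eq_upto L (D N) ((1 - ps_term 1 k) * D N.+1).
  have -> : D N = (1 - ps_term 1 k) * D N.+1
                  + ps_term ('C(N + L, L)%:R) (k *+ L.+1).
    rewrite mulrBl mul1r {3}/D mulr_sumr big_ord_recr /=.
    rewrite ps_termM mul1r addSn subn1 /= mulrS opprD addrA subrK.
    rewrite /D !big_ord_recl /= !mulr0n !bin0 -addrA; congr (_ + _).
    rewrite -sumrB; apply: eq_bigr => j _.
    rewrite /= /bump !add1n ps_termM mul1r -mulrS !addSn !addnS !subn1 /=.
    by rewrite binS natrD ps_termD addrK.
  move=> n nL; rewrite -[LHS]/(((1 - ps_term 1 k) * D N.+1) n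
                               + ps_term ('C(N + L, L)%:R) (k *+ L.+1) n).
  rewrite [X in _ + X]/ps_term ifF ?addr0 //.
  apply/negbTE/eqP => nE; move: nL; rewrite nE (bigD1 i) //= leqNgt.
  case/negP; apply: leq_trans (leq_addr _ _).
  by rewrite ffunMnE -mulr_natr !natrE leq_pmull // lt0n.
pose G := ps_geom (ps_term 1 k); have GG : eq_upto L G G by [].
rewrite exprSr => n nL; apply: etrans (eq_uptoM IH GG nL) _.
apply: etrans (eq_uptoM DS GG nL) _.
by rewrite mulrAC gE mul1r.
Qed.
End PowerSeriesTerms.

(** * Ring morphisms applied to coefficients *)

Section PowerSeriesMap.
Variables (I : finType) (A B : comNzRingType) (f : {rmorphism A -> B}).

Definition ps_map (a : power_series I A) : power_series I B := fun n => f (a n).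

Fact ps_map_is_zmod_morphism : zmod_morphism ps_map.
Proof.
move=> a b; apply/funext => n; rewrite -[RHS]/(ps_map a n - ps_map b n).
by rewrite /ps_map -rmorphB.
Qed.

Lemma ps_map_term c k : ps_map (ps_term c k) = ps_term (f c) k.
Proof.
by apply/funext => n; rewrite /ps_map /ps_term; case: eqP; rewrite ?rmorph0.
Qed.

Fact ps_map_is_monoid_morphism : monoid_morphism ps_map.
Proof.
split; first by rewrite [LHS]ps_map_term rmorph1.
move=> a b; apply/funext => n; rewrite -[RHS]/(ps_mul _ _ _) /ps_mul.
rewrite -[LHS]/(f (ps_mul a b n)) /ps_mul rmorph_sum.
by apply: eq_bigr => k _; rewrite rmorphM.
Qed.

HB.instance Definition _ := GRing.isZmodMorphism.Build _ _ ps_map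
  ps_map_is_zmod_morphism.
HB.instance Definition _ := GRing.isMonoidMorphism.Build _ _ ps_map
  ps_map_is_monoid_morphism.

Lemma ps_map_geom a : ps_map (ps_geom a) = ps_geom (ps_map a).
Proof.
apply/funext => n; rewrite /ps_geom -[LHS]/(f (\sum_(k < _) (a ^+ k) n)) rmorph_sum.
by apply: eq_bigr => k _; rewrite -rmorphXn.
Qed.

End PowerSeriesMap.

(** * The augmentation and the average E *)

Section Augmentation.
Variables (C : comNzRingType) (F : finFieldType) (w : nat).
Local Notation CG := (group_ring C F w).

Definition aug (a : CG) : C := \sum_x a x.

Fact aug_is_zmod_morphism : zmod_morphism aug.
Proof.
by move=> a b; rewrite /aug -sumrB; apply: eq_bigr => x _; rewrite !ffunE.
Qed.

Lemma aug_elt x : aug (gr_elt C x) = 1.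
Proof.
rewrite /aug (bigD1 x) //= ffunE eqxx big1 ?addr0 // => y /negPf yx.
by rewrite ffunE yx.
Qed.

Lemma sum_translate (a : CG) x : \sum_y a (y^-1 * x)%g = aug a.
Proof.
rewrite /aug [RHS](reindex_inj (inj_comp (mulgI x) (@invg_inj _))) /=.
by apply: eq_bigr => y _; rewrite class_mulC.
Qed.

Fact aug_is_monoid_morphism : monoid_morphism aug.
Proof.
split; first exact: aug_elt.
move=> a b; rewrite /aug mulr_suml.
transitivity (\sum_x \sum_y a y * b (y^-1 * x)%g).
  by apply: eq_bigr => x _; rewrite -[LHS]/(gr_mul a b x) ffunE.
rewrite exchange_big; apply: eq_bigr => y _; rewrite mulr_sumr.
by rewrite [RHS](reindex_inj (mulgI y^-1%g)).
Qed.

HB.instance Definition _ := GRing.isZmodMorphism.Build _ _ aug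
  aug_is_zmod_morphism.
HB.instance Definition _ := GRing.isMonoidMorphism.Build _ _ aug
  aug_is_monoid_morphism.

End Augmentation.

Section Average.
Variables (C : fieldType) (F : finFieldType) (w : nat).
Local Notation CG := (group_ring C F w).

Lemma gr_avgE x : gr_avg F w C x = #|F|%:R ^- w.
Proof.
rewrite /gr_avg ffunE sum_ffunE (bigD1 x) //= ffunE eqxx big1.
  by rewrite addr0 [LHS]mulr1.
by move=> y yx; rewrite ffunE eq_sym (negPf yx).
Qed.

(** This is E a = aug(a) E: all coefficients of E are equal, so convolution with E just sums those
    of [a]. *)
Lemma gr_avgM (a : CG) x : (gr_avg F w C * a) x = #|F|%:R ^- w * aug a.
Proof.
rewrite -[LHS]/(gr_mul _ _ _) ffunE -(sum_translate a x) mulr_sumr.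
by apply: eq_bigr => y _; rewrite gr_avgE.
Qed.

End Average.

(** * Generating series of monic polynomials and the sieve by irreducibles *)

Section MonicSeries.
Variables (C : comNzRingType) (F : finFieldType) (w : nat) (K : finType).
Local Notation CG := (group_ring C F w).
Local Notation PS := (power_series (option K) CG).
Implicit Types (g h : {poly F}) (s : seq (K * {poly F})).

Definition unit_exp (o : option K) : {ffun option K -> nat} := [ffun j => (j == o) : nat].

(** The sum of <g> times the monomial of exponent [phi g], meant for [phi] whose [None] component is
    the degree; restricting to degree [n None] makes each coefficient a finite sum. *)
Definition monic_series (phi : {poly F} -> {ffun option K -> nat}) : PS := fun n =>
  \sum_(g in monics F (n None) | phi (val g) == n) gr_elt C (short_class w (val g)).

(** By multiplicativity of the class and additivity of [phi], the product of the monomial of [h]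
    with the series is the part of the series coming from multiples of [h]. *)
Lemma monic_series_sieve (phi : {poly F} -> {ffun option K -> nat}) h
    (k : {ffun option K -> nat}) : h \is monic ->
    (forall g, g \is monic -> phi (h * g) = phi g + k) -> k None = (size h).-1 ->
  (1 - ps_term (gr_elt C (short_class w h)) k) * monic_series phi
  = fun n => \sum_(g in monics F (n None) | ~~ (h %| val g) && (phi (val g) == n))
               gr_elt C (short_class w (val g)).
Proof.
move=> hm phiM kN; apply/funext => n; rewrite mulrBl mul1r.
set t := ps_term _ k.
rewrite -[LHS]/(monic_series phi n - (t * monic_series phi) n).
rewrite [X in X - _](bigID (fun g : {poly_(n None).+1 F} => h %| val g)) /=.
rewrite [X in _ + X - _](_ : _ = \sum_(g in monics F (n None) |
    ~~ (h %| val g) && (phi (val g) == n)) gr_elt C (short_class w (val g))); last first.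
  by apply: eq_bigl => g; rewrite -andbA [(phi _ == _) && _]andbC.
rewrite addrAC -[RHS]add0r; congr (_ + _); apply/eqP; rewrite subr_eq0; apply/eqP.
(* The condition on [phi] moves into the summand, so that [big_monics_dvd] applies. *)
pose H g := if phi g == n then gr_elt C (short_class w g) else 0.
transitivity (\sum_(g in monics F (n None) | h %| val g) H (val g)).
  rewrite -big_mkcondr /=; apply: eq_bigl => g.
  by rewrite -!andbA [(phi _ == _) && _]andbC.
rewrite big_monics_dvd // ps_termMl -kN.
case: (boolP [forall i, (k i <= n i)%N]) => [/forallP kn|kn]; last first.
  case: ifP => // _; apply: big1 => g /monicsP[gm _].
  rewrite /H phiM //; case: eqP => // gkn; case/negP: kn; apply/forallP => o.
  by rewrite -gkn ffunE natrDE leq_addl.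
rewrite kn /monic_series ffunE mulr_sumr big_mkcondr /=.
apply: eq_bigr => g /monicsP[gm _]; rewrite /H phiM // short_classM // gr_eltM.
congr (if _ then _ else _); apply/eqP/eqP => [/ffunP gk|->]; apply/ffunP => o.
  by have := gk o; rewrite !ffunE natrDE => <-; rewrite addnK.
by rewrite !ffunE natrDE subnK.
Qed.

(** A pair [(i, h)] of [s] makes the variable [i] count the factor [h]; for empty [s] only the
    degree is recorded, which is the specialization u = 1. *)
Definition mult_exp s g : {ffun option K -> nat} :=
  [ffun o => if o is Some i then (\sum_(p <- s | p.1 == i) multiplicity p.2 g)%N
             else (size g).-1].

Lemma deg_monicM h g : h \is monic -> g \is monic ->
  (size (h * g)).-1 = ((size g).-1 + (size h).-1)%N.
Proof.
move=> hm gm; rewrite size_monicM ?monic_neq0 //.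
have := monic_neq0 hm; have := monic_neq0 gm; rewrite -!size_poly_gt0.
by case: (size h) => // a; case: (size g) => //= b _ _; rewrite addnS addnC.
Qed.

Lemma mult_exp_coprimeM s h g : h \is monic -> g \is monic ->
    (forall p, p \in s -> (1 < size p.2)%N /\ coprimep p.2 h) ->
  mult_exp s (h * g) = mult_exp s g + unit_exp None *+ (size h).-1.
Proof.
move=> hm gm hs; apply/ffunP => -[i|]; rewrite !ffunE ffunMnE !ffunE /=.
  rewrite mul0rn addr0 big_seq_cond [RHS]big_seq_cond.
  apply: eq_bigr => p /andP[/hs[sp cop] _].
  by rewrite multiplicityM_coprime ?mulf_neq0 ?monic_neq0.
by rewrite deg_monicM // natrDE -[X in (_ + X)%N]natn.
Qed.

(** Both sides are sieved to the [g] not divisible by [h], and there the two exponents agree because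
    [h] has multiplicity 0. *)
Lemma monic_series_cons s i h : h \is monic -> irreducible_poly h ->
    (forall p, p \in s -> [/\ p.2 \is monic, irreducible_poly p.2 & p.2 != h]) ->
  (1 - ps_term (gr_elt C (short_class w h))
         (unit_exp None *+ (size h).-1 + unit_exp (Some i)))
    * monic_series (mult_exp ((i, h) :: s))
  = (1 - ps_term (gr_elt C (short_class w h)) (unit_exp None *+ (size h).-1))
    * monic_series (mult_exp s).
Proof.
move=> hm hi hs.
have cops p : p \in s -> (1 < size p.2)%N /\ coprimep p.2 h.
  by move=> /hs[pm pi ph]; split; [case: pi | exact: irreducible_monic_coprime].
have consE g : mult_exp ((i, h) :: s) g =
    mult_exp s g + unit_exp (Some i) *+ multiplicity h g.
  apply/ffunP => -[j|]; rewrite !ffunE ffunMnE !ffunE /= ?mul0rn ?addr0 //.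
  rewrite big_cons /= [i == j]eq_sym natrDE.
  rewrite -[Some j == Some i]/(j == i).
  by case: (j == i); rewrite ?mul0rn ?addn0 // natn addnC.
rewrite !monic_series_sieve //.
- apply/funext => n; apply: eq_bigl => g; apply: andb_id2l => /monicsP[gm _].
  apply: andb_id2l => hg; rewrite consE multiplicity_eq0 ?mulr0n ?addr0 //.
    by case: hi.
  exact: monic_neq0.
- by move=> g gm; rewrite mult_exp_coprimeM.
- by rewrite ffunMnE ffunE natn.
- move=> g gm; rewrite !consE mult_exp_coprimeM // multiplicityMl ?monic_neq0 //.
    by rewrite mulrSr addrACA.
  by case: hi.
- by rewrite ffunE ffunMnE !ffunE natn addr0.
Qed.

(** Induction on [s], one irreducible at a time; distinctness supplies the coprimality with those
    still counted. *)
Lemma monic_series_prod s : uniq [seq p.2 | p <- s] ->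
    (forall p, p \in s -> p.2 \is monic /\ irreducible_poly p.2) ->
  \prod_(p <- s) (1 - ps_term (gr_elt C (short_class w p.2))
                        (unit_exp None *+ (size p.2).-1 + unit_exp (Some p.1)))
    * monic_series (mult_exp s)
  = \prod_(p <- s) (1 - ps_term (gr_elt C (short_class w p.2))
                          (unit_exp None *+ (size p.2).-1))
    * monic_series (mult_exp [::]).
Proof.
elim: s => [|[i h] s IH] /=; first by rewrite !big_nil.
move=> /andP[hs us] sP; have [hm hi] := sP (i, h) (mem_head _ _).
have sP' p : p \in s -> p.2 \is monic /\ irreducible_poly p.2.
  by move=> ps; apply: sP; rewrite inE ps orbT.
rewrite !big_cons /= mulrAC monic_series_cons //; last first.
  move=> p ps; have [? ?] := sP' _ ps; split=> //.
  by apply: contraNneq hs => <-; apply: map_f.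
rewrite -[LHS]mulrA -[RHS]mulrA; congr (_ * _).
by rewrite mulrC; exact: IH.
Qed.

End MonicSeries.

(** * Factorization of the counting series and its value at u = 1 *)

Section StarSeries.
Variables (C : fieldType) (F : finFieldType) (w : nat) (T : {fset nat}).
Local Notation CG := (group_ring C F w).
Local Notation PS := (power_series (option T) CG).
Local Notation q := (#|F|%:R).
Implicit Types (f h : {poly F}).

Lemma class_termE h d :
  class_term w T C h d = ps_term (gr_elt C (short_class w h)) (unit_exp None *+ d).
Proof.
by rewrite /class_term /ps_z ps_varE ps_constE ps_termX ps_termM add0r expr1n mulr1.
Qed.

Lemma class_term_uE h d (i : T) :
  class_term w T C h d * ps_u F w C i
    = ps_term (gr_elt C (short_class w h)) (unit_exp None *+ d + unit_exp (Some i)).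
Proof. by rewrite class_termE /ps_u ps_varE ps_termM mulr1. Qed.

(* 1 / (1 - q z) *)
Definition degree_series (A : comNzRingType) : power_series (option T) A := fun n =>
  if n == unit_exp None *+ n None then q ^+ n None else 0.

Lemma unit_exp_inj d e :
  unit_exp None *+ d = unit_exp None *+ e :> {ffun option T -> nat} -> d = e.
Proof. by move=> /ffunP/(_ None); rewrite !ffunMnE ffunE !natn. Qed.

Lemma ps_constMl (A : comNzRingType) c (a : power_series (option T) A) n :
  (ps_const (option T) c * a) n = c * a n.
Proof.
rewrite ps_constE ps_termMl ifT; last by apply/forallP => i; rewrite ffunE.
by congr (_ * a _); apply/ffunP => i; rewrite !ffunE subn0.
Qed.

(** Equidistribution over classes; the right side is the coefficient of any group element in q^d
    E. *)
Lemma sum_monics_classE d x : q != 0 :> C -> (w <= d)%N ->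
  (\sum_(g in monics F d) gr_elt C (short_class w (val g))) x = q ^- w * q ^+ d.
Proof.
move=> q0 wd; rewrite sum_ffunE.
under eq_bigr => g _ do rewrite ffunE eq_sym -[(_ == _)%:R]/(1 *+ _) mulrb.
rewrite -big_mkcondr sumr_const.
rewrite (eq_card (B := [set g in monics F d | short_class w (val g) == x])).
  rewrite card_monics_class // natrX -{2}(subnKC wd) exprD mulKf //.
  exact: expf_neq0.
by move=> g; rewrite [RHS]inE.
Qed.

Lemma monic_series_nil : q != 0 :> C ->
  monic_series C w (@mult_exp F T [::])
  = ps_const (option T) (gr_coavg F w C)
      * (\sum_(d < w) \sum_(h in monics F d) class_term w T C (val h) d)
    + ps_const (option T) (gr_avg F w C) * degree_series CG.
Proof.
move=> q0; pose Y d := \sum_(g in monics F d) gr_elt C (short_class w (val g)).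
have augY d : aug (Y d) = q ^+ d.
  rewrite raddf_sum (eq_bigr (fun=> 1)) => [|g _]; last exact: aug_elt.
  by rewrite sumr_const card_monics natrX.
apply/funext => n; set d := n None.
have -> : monic_series C w (@mult_exp F T [::]) n
    = if n == unit_exp None *+ d then Y d else 0.
  rewrite /monic_series big_mkcondr /= -/d.
  have mE (g : {poly_d.+1 F}) : g \in monics F d ->
      @mult_exp F T [::] (val g) = unit_exp None *+ d.
    move=> /monicsP[_ sg]; apply/ffunP => -[i|]; rewrite ffunMnE !ffunE ?big_nil //=.
      by rewrite mul0rn.
    by rewrite sg natn.
  case: eqP => nd; last first.
    by apply: big1 => g gd; rewrite mE // ifF //; apply/eqP => /esym.
  by apply: eq_bigr => g gd; rewrite mE // ifT // nd.
rewrite -[RHS]/((ps_const _ _ * _) n + (ps_const _ _ * _) n) !ps_constMl.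
rewrite /degree_series -/d ps_sumE.
under eq_bigr => e _.
  under eq_bigr => h _ do rewrite class_termE.
  rewrite ps_term_sum -/(Y e).
  over.
case: (n =P unit_exp None *+ d) => [nd|nd]; last first.
  rewrite !mulr0 big1 ?mulr0 ?addr0 // => e _; rewrite /ps_term ifF //.
  apply/eqP => ne; apply: nd; rewrite {1}ne; congr (_ *+ _).
  by rewrite /d ne ffunMnE ffunE natn.
(* Multiplying by E only sees the augmentation of [Y d], the number of monics of degree [d]. *)
have EY : gr_avg F w C * Y d = gr_avg F w C * q ^+ d.
  by apply/ffunP => x; rewrite !gr_avgM augY rmorphXn rmorph_nat.
case: (ltnP d w) => dw.
  (* Below [w], J contributes [Y d] minus E times [Y d], and the E part restores the latter by
     [EY]. *)
  rewrite (bigD1 (Ordinal dw)) //= big1 ?addr0 => [|e ed]; last first.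
    rewrite /ps_term ifF //; apply: contraNF ed; rewrite nd => /eqP/unit_exp_inj ed.
    by apply/eqP/val_inj.
  by rewrite /ps_term nd eqxx mulrBl mul1r -EY subrK.
(* From [w] on, the J sum has no term of this degree and [Y d] itself equals q^d E. *)
rewrite big1 ?mulr0 ?add0r => [|e _]; last first.
  rewrite /ps_term ifF //; apply/negbTE/eqP; rewrite nd => /unit_exp_inj ed.
  by have := ltn_ord e; rewrite -ed ltnNge dw.
by apply/ffunP => x; rewrite sum_monics_classE // gr_avgM rmorphXn rmorph_nat.
Qed.

Definition star_prod : PS :=
  \prod_(i : T) \prod_(g in monic_irr F (val i))
      ((1 - class_term w T C (val g) (val i))
       * ps_geom (class_term w T C (val g) (val i) * ps_u F w C i)).

(** Each irreducible is paired with its degree as counting variable. A list of plain polynomials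
    suits the induction and merges the types, which differ from degree to degree. *)
Definition irr_seq : seq (T * {poly F}) :=
  [seq (i, val g) | i <- enum {: T}, g <- enum (monic_irr F (val i))].

Lemma irr_seqP p : p \in irr_seq ->
  [/\ p.2 \is monic, irreducible_poly p.2 & size p.2 = (val p.1).+1].
Proof.
case/allpairsPdep => i [g [_ gi ->]] /=.
by move: gi; rewrite mem_enum => /monic_irrP[].
Qed.

Lemma irr_seq_uniq : uniq [seq p.2 | p <- irr_seq].
Proof.
rewrite map_allpairs /=.
apply: allpairs_uniq_dep => [|i _|]; rewrite ?enum_uniq //.
move=> _ _ /allpairsPdep[i [g [_ gi ->]]] /allpairsPdep[i' [g' [_ gi' ->]]] /= gg.
move: gi gi'; rewrite !mem_enum => /monic_irrP[_ sg _] /monic_irrP[_ sg' _].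
have szg : size (val g) = size (val g') := congr1 (fun p : {poly F} => size p) gg.
(* The size recovers the degree, after which both polynomials live in the same bounded type. *)
have ii : i = i' by apply: val_inj; apply: succn_inj; rewrite -[LHS]sg szg sg'.
by case: _ / ii g' gg sg' {szg} => g' gg _; congr Tagged; apply: val_inj.
Qed.

(** In the sieve identity the product on the left is inverted by the product [G] of geometric
    series. *)
Lemma monic_series_irr :
  monic_series C w (mult_exp irr_seq) = monic_series C w (mult_exp [::]) * star_prod.
Proof.
have := @monic_series_prod C F w T irr_seq irr_seq_uniq.
set Q := \prod_(p <- _) _; set R := \prod_(p <- _) _ => main.
pose G := \prod_(i : T) \prod_(g in monic_irr F (val i))
  ps_geom (class_term w T C (val g) (val i) * ps_u F w C i).
have prodE (f : T * {poly F} -> PS) : \prod_(p <- irr_seq) f p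
    = \prod_(i : T) \prod_(g in monic_irr F (val i)) f (i, val g).
  rewrite big_allpairs_dep big_enum; apply: eq_bigr => i _.
  by rewrite big_enum.
have szE i (g : {poly_(val i).+1 F}) :
    g \in monic_irr F (val i) -> (size (val g)).-1 = val i.
  by case/monic_irrP=> _ ->.
have QG : Q * G = 1.
  rewrite /Q prodE /G -big_split big1 // => i _; rewrite -big_split big1 //= => g gi.
  by rewrite szE // -class_term_uE class_geomE.
have -> : star_prod = R * G.
  rewrite /R prodE /G -big_split; apply: eq_bigr => i _.
  rewrite -big_split; apply: eq_bigr => g gi.
  by rewrite /= szE // class_termE.
rewrite mulrA [_ * R]mulrC -main; last by move=> p /irr_seqP[].
by rewrite mulrAC QG mul1r.
Qed.

Lemma mult_exp_irr_seqE (i : T) g :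
  (mult_exp irr_seq g) (Some i) = nb_irr_factors (val i) g.
Proof.
rewrite ffunE big_mkcond big_allpairs_dep big_enum /= (bigD1 i) //=.
rewrite [X in (_ + X)%N]big1 => [|j /negPf ji]; last by rewrite big1 // ji.
by rewrite addn0 big_enum /=; under eq_bigr do rewrite eqxx.
Qed.

Lemma monic_series_irr_coef m (l : T -> nat) f :
  monic_series C w (mult_exp irr_seq) (star_exponent m l) (short_class w f)
    = (nb_star w m l f)%:R.
Proof.
(* Stated for a general [n] because the type of the summation index depends on [n None]. *)
have key (n : {ffun option T -> nat}) : n None = m ->
    monic_series C w (mult_exp irr_seq) n =
      \sum_(g in monics F m | mult_exp irr_seq (val g) == n)
        gr_elt C (short_class w (val g)).
  by move=> <-.
rewrite key ?ffunE // sum_ffunE /nb_star.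
under eq_bigr => g _ do rewrite ffunE eq_sym -[(_ == _)%:R]/(1 *+ _) mulrb.
rewrite -big_mkcondr sumr_const; congr (_%:R).
apply: eq_card => g; rewrite [RHS]inE [LHS]unfold_in /= -andbA.
apply: andb_id2l => /monicsP[_ sg]; rewrite andbC; congr (_ && _).
apply/eqP/forallP => [ge i|ge]; first by rewrite -mult_exp_irr_seqE ge ffunE.
apply/ffunP => -[i|]; last by rewrite !ffunE sg.
by rewrite mult_exp_irr_seqE (eqP (ge i)) ffunE.
Qed.

End StarSeries.

(** * Expansion of products and powers *)

(** The ranges vary with [i], so all are embedded in ['I_M.+1], where ordinary distributivity
    applies; the functions within range then correspond to the dependent ones. *)
Lemma big_distr_dffun (A : comPzSemiRingType) (T : finType) (N : T -> nat)
    (f : T -> nat -> A) :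
  \prod_i \sum_(j < (N i).+1) f i j
    = \sum_(j : {dffun forall i : T, 'I_(N i).+1}) \prod_i f i (j i).
Proof.
pose M := (\sum_i N i)%N.
have NM i : ((N i).+1 <= M.+1)%N by rewrite ltnS /M (bigD1 i) //= leq_addr.
under eq_bigr => i _ do rewrite (big_ord_widen M.+1 (f i) (NM i)).
rewrite bigA_distr_big_dep.
rewrite (reindex_onto
  (fun j : {dffun forall i : T, 'I_(N i).+1} => [ffun i => inord (j i) : 'I_M.+1])
  (fun j => [ffun i => inord (j i)])) /=; last first.
  move=> j /familyP jN; apply/ffunP => i; rewrite !ffunE.
  by apply: val_inj; have := jN i; rewrite unfold_in /= => jNi; rewrite !inordK.
have jM (j : {dffun forall i : T, 'I_(N i).+1}) i : (j i < M.+1)%N.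
  exact: leq_trans (ltn_ord (j i)) (NM i).
apply: eq_big => [j|j _]; last by apply: eq_bigr => i _; rewrite ffunE inordK.
apply/andP; split.
  by apply/familyP => i; rewrite ffunE unfold_in /= inordK.
by apply/eqP/ffunP => i; rewrite !ffunE (inordK (jM j i)) inord_val.
Qed.

Section Coefficient.
Variables (C : comNzRingType) (I : finType).
Local Notation PS := (power_series I C).

Lemma ps_termMn (c : C) (k : {ffun I -> nat}) d : ps_term c k *+ d = ps_term (c *+ d) k.
Proof.
elim: d => [|d IH]; last by rewrite !mulrS IH ps_termD.
by apply/funext => n; rewrite /ps_term if_same.
Qed.

Lemma ps_term_binomial (k : {ffun I -> nat}) N :
  (1 - ps_term 1 k) ^+ N
    = \sum_(j < N.+1) ps_term ((-1) ^+ j * 'C(N, j)%:R : C) (k *+ j).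
Proof.
have -> : 1 - ps_term 1 k = 1 + ps_term (-1 : C) k.
  congr (_ + _); apply/eqP; rewrite eq_sym -addr_eq0 -ps_termD addNr.
  by apply/eqP/funext => n; rewrite /ps_term if_same.
rewrite exprDn; apply: eq_bigr => j _.
by rewrite expr1n mul1r ps_termX ps_termMn mulr_natr.
Qed.
End Coefficient.

(** * The coefficient of the scalar series *)

Section StarCoefficient.
Variables (C : fieldType) (F : finFieldType) (T : {fset nat}).
Local Notation N i := #|monic_irr F (val i)|.
Local Notation ez d := (unit_exp None *+ d : {ffun option T -> nat}).

(** The image of [star_prod] under the augmentation: every class becomes 1, so the factors of equal
    degree coincide. *)
Definition count_prod : power_series (option T) C :=
  \prod_(i : T) ((1 - ps_term 1 (ez (val i)))
                 * ps_geom (ps_term 1 (ez (val i) + unit_exp (Some i)))) ^+ N i.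

Lemma ps_map_star_prod w :
  ps_map (aug (C:=C) (F:=F) (w:=w)) (@star_prod C F w T) = count_prod.
Proof.
rewrite rmorph_prod; apply: eq_bigr => i _.
rewrite rmorph_prod -prodr_const; apply: eq_bigr => g _.
rewrite rmorphM rmorphB rmorph1 /= ps_map_geom class_term_uE class_termE.
by rewrite !ps_map_term /= aug_elt.
Qed.

Lemma ps_map_degree_series w :
  ps_map (aug (C:=C) (F:=F) (w:=w)) (@degree_series F T _) = @degree_series F T C.
Proof.
apply/funext => n; rewrite /ps_map /degree_series.
by case: eqP => _; rewrite ?rmorph0 // rmorphXn rmorph_nat.
Qed.

Lemma nat_ffun_sumE (J : Type) (r : seq J) (k : J -> {ffun option T -> nat}) o :
  (\sum_(j <- r) k j) o = (\sum_(j <- r) k j o)%N.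
Proof. by rewrite sum_ffunE. Qed.

Lemma ez_expE d o : (ez d) o = if o is Some _ then 0 else d.
Proof. by rewrite ffunMnE ffunE; case: o => [i|] /=; rewrite ?mul0rn ?natn. Qed.

(** The exponent of each u_i can come only from the geometric factors, which forces their index to
    be [l i]; the numerators range over [j], and 1 / (1 - q z) supplies the rest of z^m. *)
Lemma count_prod_coef m (l : T -> nat) :
  (@degree_series F T C * count_prod) (star_exponent m l)
  = \sum_(j : {dffun forall i : T, 'I_(N i).+1})
      ((\sum_(i : T) val i * (l i + j i) <= m)%N)%:R
      * \prod_(i : T) ('C(N i + l i - 1, l i)%:R * ((-1) ^+ j i * 'C(N i, j i)%:R))
      * #|F|%:R ^+ (m - \sum_(i : T) val i * (l i + j i)).
Proof.
(* Truncating at [L], the total degree of the exponent [n], does not affect the coefficient at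
   [n]. *)
rewrite [_ * count_prod]mulrC; set n := star_exponent m l; pose L := (\sum_o n o)%N.
(* [kappa k] and [iota j] are the exponents, [ck k] and [cj j] the coefficients, contributed by the
   geometric factors and by the numerators. *)
pose kappa (k : {ffun T -> 'I_L.+1}) : {ffun option T -> nat} :=
  \sum_i (ez (val i) + unit_exp (Some i)) *+ k i.
pose iota (j : {dffun forall i : T, 'I_(N i).+1}) : {ffun option T -> nat} :=
  \sum_i ez (val i) *+ j i.
pose cj (j : {dffun forall i : T, 'I_(N i).+1}) : C :=
  \prod_i ((-1) ^+ j i * 'C(N i, j i)%:R).
pose ck (k : {ffun T -> 'I_L.+1}) : C := \prod_i 'C(N i + k i - 1, k i)%:R.
have kappaS k i : kappa k (Some i) = k i.
  rewrite nat_ffun_sumE (bigD1 i) //= big1 ?addn0 => [|i' /negPf ii'].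
    by rewrite ffunMnE ffunE ez_expE ffunE eqxx add0r natn.
  rewrite ffunMnE ffunE ez_expE ffunE add0r.
  by rewrite -[Some i == Some i']/(i == i') eq_sym ii' mul0rn.
have kappaN k : kappa k None = (\sum_i val i * k i)%N.
  rewrite nat_ffun_sumE; apply: eq_bigr => i _.
  by rewrite ffunMnE ffunE ez_expE ffunE addr0 -mulr_natr !natrE.
have iotaS j i : iota j (Some i) = 0%N.
  by rewrite nat_ffun_sumE big1 // => i' _; rewrite ffunMnE ez_expE mul0rn.
have iotaN j : iota j None = (\sum_i val i * j i)%N.
  rewrite nat_ffun_sumE; apply: eq_bigr => i _.
  by rewrite ffunMnE ez_expE -mulr_natr !natrE.
have prodE : eq_upto L count_prod
    (\sum_j \sum_k ps_term (cj j * ck k) (iota j + kappa k)).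
  have -> : \sum_j \sum_k ps_term (cj j * ck k) (iota j + kappa k)
    = \prod_(i : T) ((1 - ps_term 1 (ez (val i))) ^+ N i
      * \sum_(k < L.+1) ps_term ('C(N i + k - 1, k)%:R)
          ((ez (val i) + unit_exp (Some i)) *+ k)).
    rewrite big_split /= bigA_distr_bigA.
    under [X in _ = X * _]eq_bigr => i _ do rewrite ps_term_binomial.
    rewrite (@big_distr_dffun _ T (fun i => N i) (fun i j =>
      ps_term ((-1) ^+ j * 'C(N i, j)%:R) (ez (val i) *+ j))).
    rewrite mulr_suml; apply: eq_bigr => j _; rewrite mulr_sumr.
    by apply: eq_bigr => k _; rewrite !ps_term_prod ps_termM.
  apply: eq_upto_prod => i; rewrite exprMn; apply: eq_uptoM => //.
  (* The coordinate of u_i, equal to 1, witnesses that the exponent is nonzero. *)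
  apply: (@ps_geom_termX _ _ _ _ _ (Some i)).
  by rewrite ffunE ez_expE ffunE eqxx.
rewrite (eq_uptoM (L := L) prodE (b' := @degree_series F T C)) //.
rewrite mulr_suml ps_sumE; apply: eq_bigr => j _.
rewrite mulr_suml ps_sumE.
have lL i : (l i < L.+1)%N.
  rewrite ltnS /L (bigD1 (Some i)) //=; apply: leq_trans (leq_addr _ _).
  by rewrite ffunE.
pose k0 : {ffun T -> 'I_L.+1} := [ffun i => Ordinal (lL i)].
have k0E i : k0 i = l i :> nat by rewrite ffunE.
(* As [degree_series] involves z alone, only [k = l] leaves an exponent on which it is nonzero. *)
rewrite (bigD1 k0) //= big1 ?addr0 => [|k kk0]; last first.
  rewrite ps_termMl; case: ifP => // /forallP kn.
  rewrite /degree_series ifF ?mulr0 //; apply: contraNF kk0 => /eqP/ffunP nk.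
  apply/eqP/ffunP => i; apply: val_inj; rewrite /= k0E.
  have := nk (Some i); have := kn (Some i).
  rewrite ez_expE !ffunE iotaS kappaS add0r => ki /eqP.
  by rewrite subn_eq0 => ik; apply/eqP; rewrite eqn_leq ki.
have sumE : (\sum_(i : T) val i * (l i + j i) = iota j None + kappa k0 None)%N.
  rewrite iotaN kappaN -big_split; apply: eq_bigr => i _ /=.
  by rewrite k0E mulnDr addnC.
rewrite ps_termMl sumE.
(* If the exponent of z already exceeds [m] the term vanishes, as the indicator does. *)
case: (leqP (iota j None + kappa k0 None)%N m) => jm; last first.
  rewrite ifF ?mul0r //; apply/negbTE/forallPn; exists None.
  by rewrite !ffunE -ltnNge.
rewrite ifT; last first.
  apply/forallP => -[i|]; last by rewrite !ffunE.
  by rewrite !ffunE iotaS kappaS k0E.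
rewrite mul1r big_split /= [X in X * _]mulrC.
have -> : \prod_i 'C(N i + l i - 1, l i)%:R = ck k0 :> C.
  by apply: eq_bigr => i _; rewrite k0E.
rewrite /degree_series ifT ?ffunE //.
apply/eqP/ffunP => -[i|]; rewrite ez_expE !ffunE //.
by rewrite iotaS kappaS k0E subnn.
Qed.

End StarCoefficient.

(** * Assembling the J part and the E part *)

Theorem theorem2 (R : realType) (F : finFieldType) (w : nat) (T : {fset nat})
    (T_gt0 : forall i : nat, i \in T -> (0 < i)%N)
    (f : {poly F}) (f_monic : f \is monic) (m : nat) (l : T -> nat) :
  let q : complex R := #|F|%:R in
  (nb_star w m l f)%:R =
    q ^ (m%:Z - w%:Z) *
      (\sum_(j : {dffun forall i : T, 'I_(#|monic_irr F (val i)|).+1})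
         ((\sum_(i : T) val i * (l i + j i) <= m)%N)%:R *
         \prod_(i : T)
           ('C(#|monic_irr F (val i)| + l i - 1, l i)%:R
            * q ^- (val i * l i)
            * 'C(#|monic_irr F (val i)|, j i)%:R
            * (-1) ^+ j i
            * q ^- (val i * j i)))
    + star_series F w T (complex R) (star_exponent m l) (short_class w f).
Proof.
set q : complex R := #|F|%:R => /=.
have q0 : q != 0.
  by rewrite /q Num.Theory.pnatr_eq0 -lt0n; apply/card_gt0P; exists 0.
rewrite -monic_series_irr_coef monic_series_irr monic_series_nil // mulrDl.
set X := ps_const _ _ * _ * _; set Y := _ * @star_prod _ _ _ _.
have -> : star_series F w T (complex R) = X by [].
rewrite -[LHS]/((X (star_exponent m l) + Y (star_exponent m l)) (short_class w f)).
rewrite ffunE addrC; congr (_ + _).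
(* The factor E turns the group-ring coefficient into q^-w times its augmentation, a coefficient of
   the scalar series. *)
rewrite /Y -mulrA ps_constMl gr_avgM -/q.
set P := @degree_series _ _ _ * _.
rewrite -[aug _]/(ps_map (aug (C:=complex R) (F:=F) (w:=w)) P (star_exponent m l)).
rewrite rmorphM /= ps_map_star_prod ps_map_degree_series count_prod_coef.
rewrite !mulr_sumr; apply: eq_bigr => j _.
case: (leqP (\sum_(i : T) val i * (l i + j i))%N m) => jm; last first.
  by rewrite !mul0r !mulr0.
rewrite !mul1r.
have -> : q ^ (m%:Z - w%:Z) = q ^- w * q ^+ m.
  by rewrite expfzDr // mulrC -exprnN.
rewrite -mulrA; congr (_ * _).
(* By [jm] the truncated subtraction in the exponent is a true one, so the power of q splits into
   q^m and one inverse power for each [i]. *)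
rewrite exprB ?unitfE // mulrCA -prodrXr -prodfV -big_split /=; congr (_ * _).
apply: eq_bigr => i _; rewrite mulnDr exprD invfM.
set a := 'C(_, _)%:R; set b := _%:R.
rewrite [(-1) ^+ _ * b]mulrC !mulrA; congr (_ * _).
by rewrite [LHS]mulrAC; congr (_ * _); exact: mulrAC.
Qed.
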